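(* There exist real sequences $(a_n)_n$ and $(b_n)_n$ with $b_n>0$ such that $$\lim_{n\to\infty}\ \sup_{x\in\mathbb{R}}\left|\frac{1}{\sum_{k=0}^n A_{n,k}}\sum_{\substack{0\le k\le n\\ k\le a_n+x b_n}}A_{n,k}-\frac{1}{\sqrt{2\pi}}\int_{-\infty}^x e^{-t^2/2}\,dt\right|=0 .$$ Moreover, the sequences given by $a_n:=n\,a$ and $b_n:=\sqrt{n}\,b$ (so $b_n^2=n\,b^2$, $b>0$) satisfy this limit relation with $$a:=\frac{1}{\sqrt5}\qquad\text{and}\qquad b^2:=\frac{2}{5}\,\frac{1}{\sqrt5}.$$
   Context: The polynomials $Q_n(x)$ are defined by $Q_0(x)=1$ and $Q_n(x)=x\sum_{k=1}^n k\,Q_{n-k}(x)$ for $n\ge 1$. The numbers $A_{n,k}$ are their coefficients: $Q_n(x)=\sum_{k=0}^n A_{n,k}x^k$. For $n\ge1$ and $0\le k\le n$ one has $A_{n,k}=\binom{n+k-1}{2k-1}$, with $A_{n,0}=0$. *)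

(* Defs.v *)
From mathcomp Require Import all_boot all_order all_algebra.
From mathcomp Require Import all_classical all_reals all_analysis.

Set Implicit Arguments.
Unset Strict Implicit.
Unset Printing Implicit Defensive.

Import Order.TTheory GRing.Theory Num.Theory.
Import numFieldNormedType.Exports.

Local Open Scope classical_set_scope.
Local Open Scope ring_scope.

(* [:: Q_n; Q_(n-1); ...; Q_0]; the course-of-values recursion needs the whole
   list. Entry i of Qlist n is Q_(n-i), so the k-th summand of Q_(n+1), namely
   k Q_(n+1-k), is read off entry k-1. *)
Fixpoint Qlist (R : nzRingType) (n : nat) : seq {poly R} :=
  if n is m.+1 then
    ('X * \sum_(1 <= k < m.+2) k%:R *: (Qlist R m)`_k.-1) :: Qlist R m
  else [:: 1].

Definition Q (R : nzRingType) (n : nat) : {poly R} := (Qlist R n)`_0.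

Lemma nth_Qlist (R : nzRingType) (n i : nat) :
  (i <= n)%N -> (Qlist R n)`_i = Q R (n - i).
Proof.
elim: n i => [|n IHn] [|i] //= lein.
by rewrite IHn.
Qed.

Lemma Q0 (R : nzRingType) : Q R 0 = 1.
Proof. by []. Qed.

Lemma QE (R : nzRingType) (n : nat) : (1 <= n)%N ->
  Q R n = 'X * \sum_(1 <= k < n.+1) k%:R *: Q R (n - k).
Proof.
case: n => // n _; rewrite {1}/Q /=; congr ('X * _).
rewrite big_nat [RHS]big_nat; apply: eq_bigr => -[|k] //= ltkn.
by rewrite nth_Qlist.
Qed.

Definition A (R : nzRingType) (n k : nat) : R := (Q R n)`_k.

Section LimitRelation.
Variable R : realType.
Implicit Types (a b : R ^nat) (x : R) (n : nat).

Definition normalized_sum a b n x : R :=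
  (\sum_(0 <= k < n.+1) A R n k)^-1 *
  \sum_(0 <= k < n.+1 | k%:R <= a n + x * b n) A R n k.

Definition gaussian_cdf x : R :=
  (Num.sqrt (2 * pi))^-1 *
  \int[lebesgue_measure]_(t in `]-oo, x]) expR (- (t ^+ 2 / 2)).

(* The supremum is taken in \bar R, since sup on R is 0 on unbounded sets. *)
Definition limit_relation a b : Prop :=
  ereal_sup (range (fun x =>
    `|normalized_sum a b n x - gaussian_cdf x|%:E)) @[n --> \oo] --> 0%E.

End LimitRelation.

(* Main.v *)
Require Import Defs.
From mathcomp Require Import all_boot all_order all_algebra.
From mathcomp Require Import all_classical all_reals all_analysis.
From mathcomp Require Import ring lra zify.

Import Order.TTheory GRing.Theory Num.Theory.
Import numFieldNormedType.Exports.

(** The numbers [A n k] are the binomials C(n+k-1, 2k-1), so two consecutive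
    ones have the explicit ratio
      A n (k+1) / A n k = (n^2 - k^2) / (2k (2k+1)).
    This ratio is close to 1 when k/n is close to the root u = a = 1/sqrt 5 of
    1 - u^2 = 4 u^2, and the logarithm of (1 - u^2) / (4 u^2) has slope
    - 25 a / 2 = - 1 / b^2 there. Adding up the logarithms of the ratios from
    n a to k therefore gives - (k - n a)^2 / (2 n b^2): compared with the entry
    at the mode, the row A n follows a Gaussian profile, and only ratios are
    needed to see it, never the size of an individual entry.

    Two facts make this precise. On a window of width O(sqrt n) around n a the
    second order error of a single ratio is O(1/n), hence O(1/sqrt n) in total
    ([log_A_gauss], [cvg_A_gauss]). On the whole row the entries are at most a
    constant times the mode times a wider Gaussian ([A_le_gauss]).

    The row, divided by its entry at the mode and drawn as a histogram with
    cells of width h = 1 / (b sqrt n), is thus a sequence of functions that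
    converges pointwise to exp (- t^2 / 2) under a fixed integrable majorant.
    By dominated convergence it converges in L^1 ([cvg_L1_scaled_histogram]).
    L^1 convergence makes the distribution functions converge uniformly with
    no further work: cutting the histogram off at x and the Gaussian at x
    changes their distance by at most one cell, so for every x the two
    integrals differ by at most the L^1 distance plus h ([histogram_cdf_dist]).
    Dividing by the total masses costs a factor 2 ([ratio_dist_le]). *)

Local Open Scope classical_set_scope.
Local Open Scope ring_scope.

(** * The coefficients and their consecutive ratios *)

(** The weight k of Q_(n-k) counts the partial sums in which Q_(n-k) occurs. *)
Lemma Q_succ (R : nzRingType) (n : nat) :
  Q R n.+1 = 'X * \sum_(0 <= i < n.+1) \sum_(0 <= j < i.+1) Q R j.
Proof.
rewrite QE//; congr (_ * _).
elim: n => [|n IHn].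
  by rewrite !big_nat1 scale1r.
rewrite [RHS]big_nat_recr//= -IHn [LHS]big_nat_recl//= scale1r subn1 /=.
rewrite [X in _ = _ + X]big_nat_recr//= [X in _ = _ + X]addrC addrCA; congr (_ + _).
rewrite [X in _ = _ + X]big_nat_rev /= !big_add1/= -big_split /=.
rewrite [LHS]big_nat [RHS]big_nat.
apply: eq_bigr => i _; rewrite add0n !subSS.
by rewrite -[X in _ = _ + X]scale1r -scalerDl natr1.
Qed.

(** The column-wise partial sums have the simplest closed form, and [Q_succ]
    expresses the next polynomial through them, which closes the induction:
    both steps are Pascal's rule. *)
Lemma coef_sumQ (R : nzRingType) (n k : nat) :
  (\sum_(0 <= j < n.+1) Q R j)`_k = 'C(n + k, k.*2)%:R.
Proof.
elim/ltn_ind: n k => -[_ k|n IHn k].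
  rewrite big_nat1 Q0 coef1 add0n -addnn.
  by case: k => [|k] //; rewrite bin_small// addnS ltnS leq_addr.
rewrite big_nat_recr//= coefD IHn// Q_succ coefXM.
case: k => [|k] /=; first by rewrite addr0 !bin0.
rewrite coef_sum.
have -> : \sum_(0 <= i < n.+1) (\sum_(0 <= j < i.+1) Q R j)`_k
    = \sum_(0 <= i < n.+1) 'C(i + k, k.*2)%:R :> R.
  by rewrite big_nat [RHS]big_nat; apply: eq_bigr => i /andP[_ lin]; exact: IHn.
have -> : \sum_(0 <= i < n.+1) 'C(i + k, k.*2)%:R
    = 'C(n + k.+1, k.*2.+1)%:R :> R.
  elim: n {IHn} => [|n IH].
    rewrite big_nat1 !add0n -addnn.
    by case: k => [|k] //; rewrite !bin_small// addnS !ltnS leq_addr.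
  by rewrite big_nat_recr//= IH -natrD !addSn !addnS binS.
by rewrite -natrD doubleS addSn [in RHS]binS.
Qed.

Lemma A_succ0 (R : nzRingType) (n : nat) : A R n.+1 0 = 0.
Proof. by rewrite /A Q_succ coefXM. Qed.

(** An entry is the difference of two consecutive partial sums of its column. *)
Lemma A_succ_succ (R : nzRingType) (n k : nat) :
  A R n.+1 k.+1 = 'C(n + k.+1, k.*2.+1)%:R.
Proof.
have : A R n.+1 k.+1 = (\sum_(0 <= j < n.+2) Q R j)`_k.+1 - (\sum_(0 <= j < n.+1) Q R j)`_k.+1.
  by rewrite [in RHS]big_nat_recr//= coefD [X in X - _]addrC addrK.
by move=> ->; rewrite !coef_sumQ doubleS addSn binS natrD [X in X - _]addrC addrK.
Qed.

Lemma A_ge0 (R : numDomainType) (n k : nat) : 0 <= A R n.+1 k.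
Proof. by case: k => [|k]; rewrite ?A_succ0// A_succ_succ ler0n. Qed.

Lemma A_gt0 (R : numDomainType) (n k : nat) : (0 < k <= n)%N -> 0 < A R n k.
Proof.
by case: n k => [|n] [|k]//; rewrite A_succ_succ ltr0n bin_gt0 => /andP[_]; lia.
Qed.

Lemma A_large (R : nzRingType) (n k : nat) : (0 < n < k)%N -> A R n k = 0.
Proof. by case: n k => [|n] [|k]// nk; rewrite A_succ_succ bin_small//; lia. Qed.

(** The asymptotic analysis uses the numbers only through this identity, their
    positivity for 0 < k <= n and their vanishing for the other k. *)
Lemma A_ratio (R : realFieldType) (n k : nat) : (0 < k <= n)%N ->
  A R n k.+1 * (4 * k%:R ^+ 2 + 2 * k%:R) = A R n k * (n%:R ^+ 2 - k%:R ^+ 2).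
Proof.
case: n k => [|n] [|k]// /andP[_ lekn]; rewrite !A_succ_succ.
have e1 := mul_bin_diag (n + k.+2) k.+1.*2.
have e2 := mul_bin_left (n + k.+1) k.*2.+1.
have e : ('C(n + k.+2, k.+1.*2.+1) * (2 * k.+1 * (2 * k.+1).+1)
        = 'C(n + k.+1, k.*2.+1) * ((n.+1 - k.+1) * (n.+1 + k.+1)))%N.
  move: e1 e2; rewrite !addnS /= doubleS.
  have -> : ((n + k).+1 - k.*2.+1 = n - k)%N by lia.
  rewrite subSS !mul2n -doubleS doubleS => e1 e2.
  rewrite mulnCA [in RHS]mulnA [(_ * (n - k))%N]mulnC -e2 -mulnA.
  by congr (_ * _)%N; rewrite mulnC -e1 mulnC addSn.
have := congr1 (fun i : nat => i%:R : R) e.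
rewrite !natrM natrB// natrD -subr_sqr => <-.
have -> : (2 * k.+1).+1%:R = 2 * k.+1%:R + 1 :> R by rewrite -natr1 natrM.
ring.
Qed.

(** * Estimates of the ratio as a function of real variables *)

Lemma center_bounds (R : realFieldType) (a : R) : 0 < a -> 5 * a ^+ 2 = 1 ->
  44 / 100 < a < 45 / 100.
Proof. by move=> a0 a5; apply/andP; split; nra. Qed.

(** To the right of the center N a, the ratio of consecutive entries is at most
    1 - q, where 1 - q is the first order expansion of the ratio of consecutive
    values of exp (- (k - N a)^2 / (4 N)). The rate 1/4 is far below the true
    one, 25 a / 4, which leaves room for a bound valid up to k = N. *)
Lemma ratio_right (R : realFieldType) (a N k : R) : 0 < a -> 5 * a ^+ 2 = 1 ->
  1 <= N -> N * a <= k <= N ->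
  N ^+ 2 - k ^+ 2 <=
    (4 * k ^+ 2 + 2 * k) * (1 - (2 * (k - N * a) + 1) / (4 * N)).
Proof.
move=> a0 a5 N1 /andP[ak kN]; have /andP[al au] := center_bounds _ _ a0 a5.
have [d dE] : exists d, k = N * a + d by exists (k - N * a); ring.
have d0 : 0 <= d by lra.
have dN : d <= 56 / 100 * N by nra.
have n1 : 0 <= N - 1 by lra.
have n0 : 0 <= N by lra.
have nd : 0 <= N - d by lra.
have c1 : 0 <= 40 * a - 8 / 5 - 16 by lra.
have c2 : 0 <= 20 - 16 * a - 8 by lra.
have c3 : 0 <= 8 * a - 4 / 5 - 2 by lra.
have c4 : 0 <= 8 - 12 * a - 2 by lra.
have c5 : 0 <= 1 - a by lra.
have h1 : 0 <= N ^+ 2 * d * (40 * a - 8 / 5 - 16) by rewrite !mulr_ge0.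
have h2 : 0 <= N * d ^+ 2 * (20 - 16 * a - 8) by rewrite !mulr_ge0 ?sqr_ge0.
have h3 : 0 <= d ^+ 2 * (N - d) by rewrite !mulr_ge0 ?sqr_ge0.
have h4 : 0 <= N * (N - 1) by rewrite mulr_ge0.
have h5 : 0 <= N * d * (N - 1) by rewrite !mulr_ge0.
have h6 : 0 <= d * (N - d) by rewrite !mulr_ge0.
have h7 : 0 <= N ^+ 2 * (8 * a - 4 / 5 - 2) by rewrite mulr_ge0 ?sqr_ge0.
have h8 : 0 <= N * d * (8 - 12 * a - 2) by rewrite !mulr_ge0.
have h9 : 0 <= N * (1 - a) by rewrite mulr_ge0.
have h10 : 0 <= d * (N - 1) by rewrite mulr_ge0.
have -> : 1 - (2 * (k - N * a) + 1) / (4 * N) = (4 * N - 2 * d - 1) / (4 * N).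
  by rewrite dE; field; lra.
rewrite mulrA ler_pdivlMr; last lra.
have E : (4 * k ^+ 2 + 2 * k) * (4 * N - 2 * d - 1) - (N ^+ 2 - k ^+ 2) * (4 * N)
  = N ^+ 2 * d * (40 * a - 8 / 5) + N * d ^+ 2 * (20 - 16 * a) - 8 * d ^+ 3
    + N ^+ 2 * (8 * a - 4 / 5) + N * d * (8 - 12 * a) - 8 * d ^+ 2
    - 2 * N * a - 2 * d
    + (N ^+ 2 * (5 * a ^+ 2 - 1)) * (4 * N - 4 / 5 - 8 / 5 * d).
  by rewrite dE; field.
rewrite -subr_ge0 E a5 subrr mulr0 mul0r addr0.
lra.
Qed.

(** The mirror image of [ratio_right]. The term 2 k of the denominator makes the
    inequality fail close to the center, hence the distance 1. *)
Lemma ratio_left (R : realFieldType) (a N k : R) : 0 < a -> 5 * a ^+ 2 = 1 ->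
  1 <= N -> 0 <= k <= N * a - 1 ->
  4 * k ^+ 2 + 2 * k <=
    (N ^+ 2 - k ^+ 2) * (1 + (2 * (k - N * a) + 1) / (4 * N)).
Proof.
move=> a0 a5 N1 /andP[k0 ka]; have /andP[al au] := center_bounds _ _ a0 a5.
have [d dE] : exists d, k = N * a - d by exists (N * a - k); ring.
have d1 : 1 <= d by lra.
have dN : d <= 45 / 100 * N by nra.
have n0 : 0 <= N by lra.
have d0 : 0 <= d by lra.
have c0 : 0 <= a by lra.
have d2 : 0 <= d - 1 by lra.
have nd : 0 <= N - d by lra.
have nd' : 0 <= 45 / 100 * N - d by lra.
have c1 : 0 <= 40 * a - 8 / 5 - 16 by lra.
have c2 : 0 <= 22 - (20 + 4 * a) by lra.
have c3 : 0 <= 4 - (8 * a - 4 / 5) by lra.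
have h1 : 0 <= N ^+ 2 * d * (40 * a - 8 / 5 - 16) by rewrite !mulr_ge0.
have h2 : 0 <= N * d ^+ 2 * (22 - (20 + 4 * a)) by rewrite !mulr_ge0 ?sqr_ge0.
have h3 : 0 <= N * d * (45 / 100 * N - d) by rewrite !mulr_ge0.
have h4 : 0 <= N ^+ 2 * (4 - (8 * a - 4 / 5)) by rewrite mulr_ge0 ?sqr_ge0.
have h5 : 0 <= N ^+ 2 * (d - 1) by rewrite !mulr_ge0 ?sqr_ge0.
have h6 : 0 <= d * (N - d) by rewrite !mulr_ge0.
have h7 : 0 <= d ^+ 3 by rewrite exprn_ge0.
have h8 : 0 <= N * d * a by rewrite !mulr_ge0.
have h9 : 0 <= N * d by rewrite !mulr_ge0.
have h10 : 0 <= N ^+ 2 by rewrite sqr_ge0.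
have -> : 1 + (2 * (k - N * a) + 1) / (4 * N) = (4 * N - 2 * d + 1) / (4 * N).
  by rewrite dE; field; lra.
rewrite mulrA ler_pdivlMr; last lra.
have E : (N ^+ 2 - k ^+ 2) * (4 * N - 2 * d + 1) - (4 * k ^+ 2 + 2 * k) * (4 * N)
  = N ^+ 2 * d * (40 * a - 8 / 5) - N * d ^+ 2 * (20 + 4 * a) + 2 * d ^+ 3
    - N ^+ 2 * (8 * a - 4 / 5) + N * d * (8 + 2 * a) - d ^+ 2
    + (N ^+ 2 * (5 * a ^+ 2 - 1)) * (- 4 * N - 1 / 5 + 2 / 5 * d).
  by rewrite dE; field.
rewrite -subr_ge0 E a5 subrr mulr0 mul0r addr0.
lra.
Qed.

Lemma ln1D_sub_le (R : realType) (y : R) : `|y| <= 1 / 2 ->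
  `|ln (1 + y) - y| <= 2 * y ^+ 2.
Proof.
rewrite ler_norml => /andP[y1 y2].
have up : ln (1 + y) <= y by apply: le_ln1Dx; lra.
have p : 0 < 1 + y by lra.
have lo : 1 - (1 + y)^-1 <= ln (1 + y).
  have := @le_ln1Dx R ((1 + y)^-1 - 1).
  rewrite [1 + (_ - 1)]addrC subrK lnV ?posrE//.
  have : 0 < (1 + y)^-1 by rewrite invr_gt0.
  lra.
have lo' : y - 2 * y ^+ 2 <= 1 - (1 + y)^-1.
  rewrite -subr_ge0.
  have -> : 1 - (1 + y)^-1 - (y - 2 * y ^+ 2) = y ^+ 2 * (1 + 2 * y) / (1 + y).
    by field; rewrite gt_eqF.
  by rewrite mulr_ge0 ?invr_ge0 ?(ltW p)// mulr_ge0 ?sqr_ge0//; lra.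
rewrite ler_norml; apply/andP; split; first lra.
have := sqr_ge0 y; lra.
Qed.

(** With k = n (a + s) and e = 1/n, the numerator and the denominator of the
    ratio are n^2 times the two arguments of [ln]. Both arguments are 4/5 at
    s = e = 0, because a is the point where the ratio is 1, and the
    logarithmic slopes in s there are - 5 a / 2 and 10 a. *)
Lemma log_ratio_center (R : realType) (a s e : R) : 0 < a -> 5 * a ^+ 2 = 1 ->
  `|s| <= 1 / 100 -> 0 <= e <= 1 / 100 ->
  `|ln (1 - (a + s) ^+ 2) - ln (4 * (a + s) ^+ 2 + 2 * (a + s) * e)
    + 25 / 2 * a * s| <= 200 * (s ^+ 2 + e).
Proof.
move=> a0 a5 s1 /andP[e0 e1]; have /andP[al au] := center_bounds _ _ a0 a5.
have ss : s ^+ 2 <= 1 / 100 * `|s|.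
  by rewrite -(real_normK (num_real s)) expr2 ler_wpM2r.
have as_ : `|a * s| <= 45 / 100 * `|s|.
  by rewrite normrM gtr0_norm// ler_wpM2r ?normr_ge0// ltW.
have se : `|(a + s) * e| <= e / 2.
  rewrite normrM (ger0_norm e0) mulrC ler_wpM2l//.
  by move: s1; clear - al au; rewrite !ler_norml => ?; apply/andP; split; lra.
(* The relative deviations of the two arguments from their central value. *)
have [y1 y1E] : exists y1, y1 = - (5 / 2 * (a * s)) - 5 / 4 * s ^+ 2 by eexists.
have [y2 y2E] : exists y2, y2 = 10 * (a * s) + 5 * s ^+ 2 + 5 / 2 * ((a + s) * e).
  by eexists.
have E1 : 1 - (a + s) ^+ 2 = 4 / 5 * (1 + y1) by clear - a5 y1E; lra.
have E2 : 4 * (a + s) ^+ 2 + 2 * (a + s) * e = 4 / 5 * (1 + y2).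
  by clear - a5 y2E; lra.
have r : `|y1 - y2 + 25 / 2 * a * s| <= 7 * s ^+ 2 + 2 * e.
  have -> : y1 - y2 + 25 / 2 * a * s = - (25 / 4 * s ^+ 2 + 5 / 2 * ((a + s) * e)).
    by rewrite y1E y2E; field.
  rewrite normrN; have := sqr_ge0 s; move: se; rewrite !ler_norml => /andP[].
  by clear - e0; move=> *; apply/andP; split; lra.
have y1s : `|y1| <= 2 * `|s|.
  rewrite y1E; have := sqr_ge0 s; move: as_ ss; rewrite !ler_norml => /andP[].
  by clear; move=> *; apply/andP; split; lra.
have y2s : `|y2| <= 5 * `|s| + 2 * e.
  rewrite y2E; have := sqr_ge0 s; move: as_ ss se; rewrite !ler_norml.
  move=> /andP[+ +] + /andP[].
  by clear - e0; move=> *; apply/andP; split; lra.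
have y1q : y1 ^+ 2 <= 4 * s ^+ 2.
  rewrite -(real_normK (num_real s)) -(real_normK (num_real y1)).
  rewrite -[4](_ : 2 ^+ 2 = 4); last by ring.
  by rewrite -exprMn ler_sqr ?nnegrE ?mulr_ge0.
have y2q : y2 ^+ 2 <= 50 * s ^+ 2 + 8 * e.
  rewrite -(real_normK (num_real s)) -(real_normK (num_real y2)).
  have : `|y2| ^+ 2 <= (5 * `|s| + 2 * e) ^+ 2.
    by rewrite ler_sqr ?nnegrE ?addr_ge0 ?mulr_ge0.
  have := sqr_ge0 (5 * `|s| - 2 * e).
  have : e ^+ 2 <= e.
    by rewrite expr2 ler_piMl// (le_trans e1)//; clear; lra.
  by clear - e0; move=> *; lra.
have y1h : `|y1| <= 1 / 2 by clear - y1s s1; lra.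
have y2h : `|y2| <= 1 / 2 by clear - y2s s1 e1; lra.
have l1 := ln1D_sub_le _ _ y1h.
have l2 := ln1D_sub_le _ _ y2h.
have p1 : 0 < 1 + y1.
  by move: y1h; clear; rewrite ler_norml => /andP[? ?]; lra.
have p2 : 0 < 1 + y2.
  by move: y2h; clear; rewrite ler_norml => /andP[? ?]; lra.
have p3 : 0 < 4 / 5 :> R by clear; lra.
rewrite E1 E2; move: (4 / 5) p3 => c p3; rewrite !lnM ?posrE//.
have -> : ln c + ln (1 + y1) - (ln c + ln (1 + y2)) + 25 / 2 * a * s
    = (ln (1 + y1) - y1) - (ln (1 + y2) - y2) + (y1 - y2 + 25 / 2 * a * s).
  by ring.
apply: (le_trans (ler_normD _ _)).
apply: (le_trans (lerD (ler_normB _ _) r)).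
apply: (le_trans (lerD (lerD l1 l2) (lexx _))).
by have := sqr_ge0 s; move: y1q y2q e0; clear; move=> *; lra.
Qed.

(** * A Gaussian majorant of the whole row *)

(** Multiplied by exp ((k - n a)^2 / (4 n)), the row is nondecreasing up to the
    mode m and nonincreasing from m + 1 on, so it is bounded by its values at
    these two places. The step from m to m + 1 straddles the center and is
    covered by neither [ratio_left] nor [ratio_right], but there the ratio
    is at most 2. *)
Section Domination.
Variables (R : realType) (a : R) (n m : nat).
Hypotheses (a0 : 0 < a) (a5 : 5 * a ^+ 2 = 1) (n10 : (10 <= n)%N).
Hypothesis nam : m%:R <= n%:R * a < m.+1%:R.

Let N1 : 1 <= n%:R :> R. Proof. by rewrite ler1n; lia. Qed.
Let aun : a <= 1.
Proof. by have /andP[_ ?] := center_bounds _ _ a0 a5; lra. Qed.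

Let y (k : nat) := A R n k * expR ((k%:R - n%:R * a) ^+ 2 / (4 * n%:R)).
Let q (k : nat) : R := (2 * (k%:R - n%:R * a) + 1) / (4 * n%:R).

Let A0 k : 0 <= A R n k.
Proof. by case: n n10 => // n' _; exact: A_ge0. Qed.

Let D0 k : (0 < k)%N -> 0 < 4 * k%:R ^+ 2 + 2 * k%:R :> R.
Proof. by move=> k0; rewrite addr_gt0 ?mulr_gt0 ?exprn_gt0 ?ltr0n. Qed.

Let yS k : y k.+1 = A R n k.+1 * expR (q k)
  * expR ((k%:R - n%:R * a) ^+ 2 / (4 * n%:R)).
Proof.
rewrite /y -mulrA -expRD; congr (_ * expR _); rewrite /q -natr1; field.
by rewrite pnatr_eq0; lia.
Qed.

Let y_right k : (m < k)%N -> y k.+1 <= y k.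
Proof.
move=> mk; rewrite yS /y ler_wpM2r ?expR_ge0//.
have [nk|kn] := ltnP n k.+1.
  by rewrite A_large ?mul0r//; lia.
rewrite -(ler_pM2r (expR_gt0 (- q k))) -mulrA expRxMexpNx_1 mulr1.
have k0 : (0 < k)%N by lia.
rewrite -(ler_pM2r (D0 _ k0)) A_ratio; last lia.
rewrite -mulrA ler_wpM2l// mulrC.
apply: (le_trans (ratio_right _ a n%:R k%:R a0 a5 N1 _)).
  rewrite ler_nat (ltnW kn) andbT.
  by move: nam => /andP[_ /ltW h]; rewrite (le_trans h)// ler_nat.
by rewrite ler_wpM2l ?(ltW (D0 _ k0))//; exact: expR_ge1Dx.
Qed.

Let y_left k : (0 < k < m)%N -> y k <= y k.+1.
Proof.
move=> /andP[k0 km].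
have kna : k%:R <= n%:R * a - 1.
  rewrite lerBrDr natr1; move: nam => /andP[h _].
  by rewrite (le_trans _ h)// ler_nat.
have kn : (k <= n)%N.
  rewrite -(ler_nat R) (le_trans kna)// lerBlDr.
  by rewrite (@le_trans _ _ n%:R) ?lerDl// ler_piMr.
rewrite yS /y ler_wpM2r ?expR_ge0//.
rewrite -(ler_pM2r (D0 _ k0)) mulrAC A_ratio ?k0// -mulrA ler_wpM2l//.
apply: (le_trans (ratio_left _ a n%:R k%:R a0 a5 N1 _)).
  by rewrite ler0n.
rewrite ler_wpM2l ?expR_ge1Dx// subr_ge0 ler_sqr ?nnegrE//.
by rewrite ler_nat.
Qed.

Let nm : (n <= 3 * m)%N.
Proof.
rewrite -(ler_nat R) natrM.
move: nam => /andP[_]; rewrite -natr1.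
have /andP[al _] := center_bounds _ _ a0 a5.
have : 10 <= n%:R :> R by rewrite ler_nat.
by move: al; nra.
Qed.

Let mn : (m <= n)%N.
Proof.
move: nam => /andP[h _]; rewrite -(ler_nat R) (le_trans h)//.
by rewrite ler_piMr.
Qed.

Let m0 : (0 < m)%N. Proof. lia. Qed.

Let y_mode : y m <= A R n m * expR (1 / 2).
Proof.
rewrite ler_wpM2l// ler_expR ler_pdivrMr ?mulr_gt0//; last first.
  by rewrite (lt_le_trans _ N1).
by move: nam N1; rewrite -natr1; nra.
Qed.

Let y_modeS : y m.+1 <= 2 * expR (1 / 2) * y m.
Proof.
have h1 : A R n m.+1 <= A R n m * 2.
  rewrite -(ler_pM2r (D0 _ m0)) A_ratio ?m0// -mulrA ler_wpM2l//.
  have : n%:R <= 3 * m%:R :> R by rewrite -natrM ler_nat.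
  have : 0 <= m%:R :> R by [].
  by move: N1; nra.
have h2 : expR (q m) <= expR (1 / 2).
  rewrite ler_expR ler_pdivrMr ?mulr_gt0//; last first.
    by rewrite (lt_le_trans _ N1).
  by move: nam N1; rewrite -natr1; lra.
rewrite yS /y mulrA ler_wpM2r ?expR_ge0//.
rewrite [leRHS]mulrC mulrA; apply: ler_pM => //; exact: expR_ge0.
Qed.

Let y_le k : y k <= 2 * expR 1 * A R n m.
Proof.
have c0 : 0 <= expR (1 / 2) :> R by exact: expR_ge0.
have c1 : 1 <= expR (1 / 2) :> R.
  by rewrite (le_trans _ (expR_ge1Dx _))// lerDl.
have cc : expR 1 = expR (1 / 2) * expR (1 / 2) :> R.
  by rewrite -expRD -splitr.
have ym : y m <= 2 * expR 1 * A R n m.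
  apply: (le_trans y_mode); rewrite mulrC ler_wpM2r// cc.
  by move: c1; nra.
have yr j : y (m.+1 + j)%N <= 2 * expR 1 * A R n m.
  elim: j => [|j IH]; last first.
    by rewrite addnS (le_trans (y_right _ _))// addSn ltnS leq_addr.
  rewrite addn0 (le_trans y_modeS)// cc.
  have -> : 2 * (expR (1 / 2) * expR (1 / 2)) * A R n m
    = 2 * expR (1 / 2) * (A R n m * expR (1 / 2)) by ring.
  by rewrite ler_wpM2l// mulr_ge0.
have yl j : y (m - j)%N <= 2 * expR 1 * A R n m.
  elim: j => [|j IH]; first by rewrite subn0.
  have [mj|mj] := leqP m j.
    have e : (m - j.+1 = m - j)%N.
      by move: (mj) (leqW mj); rewrite -!subn_eq0 => /eqP -> /eqP ->.
    by rewrite e.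
  have [mj'|mj'] := eqVneq m j.+1.
    rewrite mj' subnn /y; case: n n10 => // n' _.
    by rewrite A_succ0 mul0r !mulr_ge0 ?expR_ge0// A_ge0.
  rewrite (le_trans _ IH)// -(subnSK mj) y_left// subn_gt0 ltn_subrL m0.
  by rewrite ltn_neqAle [_ == m]eq_sym mj' mj.
have [km|mk] := leqP k m.
  by rewrite -(subKn km).
by rewrite -(subnKC mk).
Qed.

Lemma A_le_gauss k : A R n k <=
  2 * expR 1 * A R n m * expR (- ((k%:R - n%:R * a) ^+ 2 / (4 * n%:R))).
Proof.
by rewrite expRN ler_pdivlMr ?expR_gt0//; exact: y_le.
Qed.

End Domination.

(** * The Gaussian profile around the mode *)

(** The logarithm of an entry relative to the expected Gaussian profile: the
    factor 25 a / 4 is 1 / (2 b^2). *)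
Definition gauss_defect (R : realType) (a : R) (n k : nat) : R :=
  ln (A R n k) + 25 / 4 * a * ((k%:R - n%:R * a) ^+ 2 / n%:R).

Arguments gauss_defect {R}.

Lemma window_index (R : realFieldType) (a : R) (n k : nat) :
  0 < a -> 5 * a ^+ 2 = 1 -> (100 <= n)%N ->
  `|k%:R - n%:R * a| <= n%:R / 100 -> (0 < k < n)%N.
Proof.
move=> a0 a5 n100; have /andP[al au] := center_bounds _ _ a0 a5.
have N100 : 100 <= n%:R :> R by rewrite ler_nat.
rewrite ler_norml => /andP[h1 h2].
apply/andP; split; rewrite -(ltr_nat R); clear n100; nra.
Qed.

(** The quadratic term of [gauss_defect] cancels the linear part of the
    logarithm of the ratio, so what is left is of second order. *)
Lemma gauss_defect_step (R : realType) (a : R) (n k : nat) :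
  0 < a -> 5 * a ^+ 2 = 1 -> (100 <= n)%N ->
  `|k%:R - n%:R * a| <= n%:R / 100 ->
  `|gauss_defect a n k.+1 - gauss_defect a n k|
    <= 200 * ((k%:R - n%:R * a) / n%:R) ^+ 2 + 204 / n%:R.
Proof.
move=> a0 a5 n100 hk; have /andP[k0 kn] := window_index _ _ _ _ a0 a5 n100 hk.
have /andP[al au] := center_bounds _ _ a0 a5.
have n0 : 0 < n%:R :> R by rewrite ltr0n; lia.
have nz : n%:R != 0 :> R by rewrite gt_eqF.
set s := (k%:R - n%:R * a) / n%:R.
have kE : k%:R = n%:R * (a + s) by rewrite /s; field.
have hs : `|s| <= 1 / 100.
  rewrite /s normrM normfV (gtr0_norm n0) ler_pdivrMr//.
  by move: hk; clear; lra.
have he : 0 <= (n%:R^-1 : R) <= 1 / 100.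
  by rewrite invr_ge0 ler0n/= div1r lef_pV2 ?posrE// ler_nat.
have := log_ratio_center _ _ _ _ a0 a5 hs he.
set L := ln (1 - _) - ln _ => hL.
have Ak : 0 < A R n k by apply: A_gt0; rewrite k0 ltnW.
have Ak1 : 0 < A R n k.+1 by apply: A_gt0.
have k0' : 0 < k%:R :> R by rewrite ltr0n.
have as0 : 0 < a + s by rewrite -(pmulr_rgt0 _ n0) -kE.
have as1 : a + s < 1 by rewrite -(ltr_pM2l n0) -kE mulr1 ltr_nat.
have p1 : 0 < 1 - (a + s) ^+ 2 by clear - as0 as1; nra.
have p2 : 0 < 4 * (a + s) ^+ 2 + 2 * (a + s) / n%:R.
  by rewrite addr_gt0 ?mulr_gt0 ?exprn_gt0 ?invr_gt0.
have E : ln (A R n k.+1) - ln (A R n k) = L.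
  have := A_ratio R n k.
  rewrite k0 (ltnW kn) => /(_ isT).
  have -> : 4 * k%:R ^+ 2 + 2 * k%:R
      = n%:R ^+ 2 * (4 * (a + s) ^+ 2 + 2 * (a + s) / n%:R) :> R.
    by rewrite kE; field.
  have -> : n%:R ^+ 2 - k%:R ^+ 2 = n%:R ^+ 2 * (1 - (a + s) ^+ 2) :> R.
    by rewrite kE; ring.
  rewrite /L; move: p1 p2.
  move: (1 - (a + s) ^+ 2) (4 * _ + _) => x y x0 y0.
  rewrite mulrCA [RHS]mulrCA => /(mulfI (expf_neq0 2 nz)) /(congr1 (@ln R)).
  by rewrite !lnM ?posrE//; clear; lra.
have -> : gauss_defect a n k.+1 - gauss_defect a n k
    = (L + 25 / 2 * a * s) + 25 / 4 * a / n%:R.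
  by rewrite /gauss_defect -E /s -natr1; field.
apply: (le_trans (ler_normD _ _)).
apply: (le_trans (lerD hL (lexx _))).
have c0 : 0 <= 25 / 4 * a by lra.
rewrite normrM normfV (gtr0_norm n0) ger0_norm// mulrDr -addrA lerD2l -mulrDl.
by rewrite ler_wpM2r ?invr_ge0 ?(ltW n0)//; lra.
Qed.

Lemma near_sqrt_ge (R : realType) (M : R) :
  \forall n \near \oo, M <= Num.sqrt n%:R.
Proof.
near=> n.
rewrite (@le_trans _ _ `|M|) ?ler_norm// -sqrtr_sqr ler_wsqrtr//.
by near: n; exact: nbhs_infty_ger.
Unshelve. all: by end_near. Qed.

Lemma cvg_invsqrt (R : realType) :
  (Num.sqrt n%:R)^-1 @[n --> \oo] --> (0 : R).
Proof.
apply/cvgr0Pnorm_le => e e0; near=> n.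
have : e^-1 <= Num.sqrt n%:R by near: n; exact: near_sqrt_ge.
move=> h; have s0 : 0 < Num.sqrt n%:R :> R by rewrite (lt_le_trans _ h)// invr_gt0.
by rewrite ger0_norm ?invr_ge0 ?(ltW s0)// -(invrK e) lef_pV2// posrE invr_gt0.
Unshelve. all: by end_near. Qed.

(** Across a window of width T sqrt n each step costs O((T^2 + 1) / n). *)
Lemma gauss_defect_window (R : realType) (a T : R) (n i j : nat) :
  0 < a -> 5 * a ^+ 2 = 1 -> (100 <= n)%N -> 0 <= T ->
  100 * T <= Num.sqrt n%:R ->
  `|i%:R - n%:R * a| <= T * Num.sqrt n%:R ->
  `|j%:R - n%:R * a| <= T * Num.sqrt n%:R ->
  `|gauss_defect a n i - gauss_defect a n j|
    <= `|i%:R - j%:R| * ((200 * T ^+ 2 + 204) / n%:R).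
Proof.
move=> a0 a5 n100 T0 Tn.
wlog ij : i j / (j <= i)%N.
  move=> H; have [/H//|/ltnW/H{}H hi hj] := leqP j i.
  by rewrite distrC [X in _ <= X * _]distrC; exact: H.
move=> hi hj; rewrite -(subnKC ij) natrD [j%:R + _]addrC addrK normr_nat.
move: (leqnn (i - j)); move: {-2}(i - j)%N => d.
have n0 : 0 < n%:R :> R by rewrite ltr0n (leq_trans _ n100).
have sq : Num.sqrt n%:R ^+ 2 = n%:R :> R by rewrite sqr_sqrtr// ltW.
have s0 : 0 <= Num.sqrt n%:R :> R by exact: sqrtr_ge0.
elim: d => [|d IH] hd.
  by rewrite addn0 subrr normr0 mul0r.
have hw : `|(j + d)%N%:R - n%:R * a| <= T * Num.sqrt n%:R.
  have : (j + d)%N%:R <= i%:R :> R.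
    by rewrite ler_nat -(subnKC ij) leq_add2l ltnW.
  have : j%:R <= (j + d)%N%:R :> R by rewrite ler_nat leq_addr.
  move: hi hj; rewrite !ler_norml => /andP[_ h1] /andP[h2 _] h3 h4.
  by apply/andP; split; [clear - h2 h3|clear - h1 h4]; lra.
have hw2 : `|(j + d)%N%:R - n%:R * a| <= n%:R / 100.
  apply: (le_trans hw); rewrite ler_pdivlMr// -[in leRHS]sq expr2.
  by rewrite mulrAC ler_wpM2r// mulrC.
have st := gauss_defect_step _ _ _ _ a0 a5 n100 hw2.
have sm : ((((j + d)%N)%:R - n%:R * a) / n%:R) ^+ 2 <= T ^+ 2 / n%:R.
  rewrite expr_div_n ler_pdivrMr ?exprn_gt0// [n%:R ^+ 2]expr2 mulrA.
  rewrite mulfVK ?gt_eqF//; move: hw.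
  by rewrite -ler_sqr ?nnegrE ?mulr_ge0// (real_normK (num_real _)) exprMn sq.
rewrite addnS -natr1 mulrDl mul1r.
have -> : gauss_defect a n (j + d).+1 - gauss_defect a n j
    = (gauss_defect a n (j + d) - gauss_defect a n j)
      + (gauss_defect a n (j + d).+1 - gauss_defect a n (j + d)) by ring.
rewrite (le_trans (ler_normD _ _))// lerD//; first by apply: IH; exact: ltnW.
apply: (le_trans st); rewrite [leRHS]mulrDl lerD2r.
by rewrite -mulrA ler_wpM2l ?ler0n.
Qed.

(** The indices k and m are only required to be within 1 of n a + u sqrt n and
    n a, since they will be integer parts of these numbers. *)
Lemma log_A_gauss (R : realType) (a u T : R) (n k m : nat) :
  0 < a -> 5 * a ^+ 2 = 1 -> (100 <= n)%N -> `|u| + 1 <= T ->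
  100 * T <= Num.sqrt n%:R ->
  `|k%:R - n%:R * a - u * Num.sqrt n%:R| <= 1 ->
  `|m%:R - n%:R * a| <= 1 ->
  `|ln (A R n k) - ln (A R n m) + 25 / 4 * a * u ^+ 2|
    <= ((T + 1) * (200 * T ^+ 2 + 204) + 3 * (2 * T + 1)) / Num.sqrt n%:R.
Proof.
move=> a0 a5 n100 uT Tn hk hm.
have n0 : 0 < n%:R :> R by rewrite ltr0n (leq_trans _ n100).
have /andP[al au] := center_bounds _ _ a0 a5.
have T1 : 1 <= T by rewrite (le_trans _ uT)// lerDr.
have : n%:R = Num.sqrt n%:R ^+ 2 :> R by rewrite sqr_sqrtr// ltW.
move: (@gauss_defect_window R a T n k m a0 a5 n100 (le_trans ler01 T1) Tn).
move: (Num.sqrt n%:R) Tn hk => w Tw hk win nw.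
have w1 : 1 <= w by clear - T1 Tw; lra.
have w0 : 0 < w by rewrite (lt_le_trans _ w1).
have wz : w != 0 by rewrite gt_eqF.
have iw : w^-1 ^+ 2 <= w^-1 by rewrite expr2 ler_piMl ?invr_ge0 ?(ltW w0)// invf_le1.
set x := k%:R - n%:R * a in hk win *.
set y := m%:R - n%:R * a in hm win *.
have uwT : `|u * w| <= (T - 1) * w.
  by rewrite normrM (gtr0_norm w0) ler_wpM2r ?(ltW w0)//; clear - uT; lra.
have xT : `|x| <= T * w.
  have -> : x = (x - u * w) + u * w by rewrite subrK.
  rewrite (le_trans (ler_normD _ _))// (le_trans (lerD hk uwT))//.
  by clear - w1; lra.
have yT : `|y| <= T * w.
  by rewrite (le_trans hm)// -[1]mulr1 ler_pM.
have xyT : `|x - y| <= (T + 1) * w.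
  have -> : x - y = (x - u * w) + u * w - y by ring.
  rewrite (le_trans (ler_normB _ _))// (le_trans (lerD (ler_normD _ _) hm))//.
  rewrite (le_trans (lerD (lerD hk uwT) (lexx _)))//.
  by clear - w1; lra.
have := win xT yT.
have -> : k%:R - m%:R = x - y by rewrite /x /y; ring.
move=> {}win.
have {}win : `|gauss_defect a n k - gauss_defect a n m|
    <= (T + 1) * (200 * T ^+ 2 + 204) / w.
  apply: (le_trans win); rewrite nw.
  have -> : (T + 1) * (200 * T ^+ 2 + 204) / w
    = (T + 1) * w * ((200 * T ^+ 2 + 204) / w ^+ 2) by field.
  have : 0 <= 200 * T ^+ 2 + 204.
    apply: addr_ge0; last exact: ler0n.
    by apply: mulr_ge0; [exact: ler0n|exact: sqr_ge0].
  by move: (200 * _ + _) => C C0; rewrite ler_wpM2r// divr_ge0 ?sqr_ge0.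
have hx : `|(x / w) ^+ 2 - u ^+ 2| <= 2 * T / w.
  have -> : (x / w) ^+ 2 - u ^+ 2 = (x - u * w) / w * (x / w + u) by field.
  rewrite normrM [leLHS]mulrC; apply: ler_pM => //.
    rewrite (le_trans (ler_normD _ _))// normrM normfV (gtr0_norm w0).
    have : `|x| / w <= T by rewrite ler_pdivrMr.
    by clear - uT; lra.
  by rewrite normrM normfV (gtr0_norm w0) ler_pdivrMr// mulVf// .
have hy : `|(y / w) ^+ 2| <= 1 / w.
  rewrite normrX normrM normfV (gtr0_norm w0) exprMn div1r (le_trans _ iw)//.
  by rewrite ler_piMl ?sqr_ge0// expr_le1.
have -> : ln (A R n k) - ln (A R n m) + 25 / 4 * a * u ^+ 2
  = (gauss_defect a n k - gauss_defect a n m)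
    + 25 / 4 * a * ((y / w) ^+ 2 - ((x / w) ^+ 2 - u ^+ 2)).
  by rewrite /gauss_defect -/x -/y nw; field.
rewrite [leRHS]mulrDl (le_trans (ler_normD _ _))// lerD//.
have c0 : 0 <= 25 / 4 * a by clear - a0; lra.
have c3 : 25 / 4 * a <= 3 by clear - au; lra.
rewrite normrM (ger0_norm c0) -[leRHS]mulrA; apply: ler_pM => //.
rewrite (le_trans (ler_normB _ _))// (le_trans (lerD hy hx))// -mulrDl.
by rewrite addrC.
Qed.

Lemma cvg_A_gauss (R : realType) (a u : R) (k m : nat -> nat) :
  0 < a -> 5 * a ^+ 2 = 1 ->
  (\forall n \near \oo, `|(k n)%:R - n%:R * a - u * Num.sqrt n%:R| <= 1) ->
  (\forall n \near \oo, `|(m n)%:R - n%:R * a| <= 1) ->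
  A R n (k n) / A R n (m n) @[n --> \oo] --> expR (- (25 / 4 * a * u ^+ 2)).
Proof.
move=> a0 a5 hk hm.
have L : ln (A R n (k n)) - ln (A R n (m n)) @[n --> \oo] -->
    - (25 / 4 * a * u ^+ 2).
  pose T := `|u| + 1.
  pose K := (T + 1) * (200 * T ^+ 2 + 204) + 3 * (2 * T + 1).
  apply/cvgrPdist_lt => e e0.
  have : K * (Num.sqrt n%:R)^-1 @[n --> \oo] --> K * 0.
    by apply: cvgM; [exact: cvg_cst|exact: cvg_invsqrt].
  rewrite mulr0 => /cvgr0Pnorm_lt Kw; near=> n.
  rewrite distrC opprK.
  apply: (@le_lt_trans _ _ (K / Num.sqrt n%:R)).
    apply: log_A_gauss => //.
    - by near: n; exists 100%N.
    - by near: n; exact: near_sqrt_ge.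
    - by near: n.
    - by near: n.
  by apply: (le_lt_trans (ler_norm _)); near: n; exact: Kw.
have pos (j : nat -> nat) v :
    (\forall n \near \oo, `|(j n)%:R - n%:R * a - v * Num.sqrt n%:R| <= 1) ->
    \forall n \near \oo, 0 < A R n (j n).
  move=> hj; near=> n.
  have n100 : (100 <= n)%N by near: n; exists 100%N.
  have n0 : 0 < n%:R :> R by rewrite ltr0n (leq_trans _ n100).
  have wT : 100 * (`|v| + 1) <= Num.sqrt n%:R by near: n; exact: near_sqrt_ge.
  have s1 : 1 <= Num.sqrt n%:R :> R by near: n; exact: near_sqrt_ge.
  have jn : `|(j n)%:R - n%:R * a - v * Num.sqrt n%:R| <= 1 by near: n.
  have /andP[j0 jn'] : (0 < j n < n)%N.
    apply: (window_index _ _ _ _ a0 a5 n100).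
    rewrite -(subrK (v * Num.sqrt n%:R) (_ - _)).
    rewrite (le_trans (ler_normD _ _))// normrM (ger0_norm (sqrtr_ge0 _)).
    have sq : Num.sqrt n%:R * Num.sqrt n%:R = n%:R :> R.
      by rewrite -expr2 sqr_sqrtr// ltW.
    have : 100 * (`|v| + 1) * Num.sqrt n%:R <= n%:R.
      by rewrite -[leRHS]sq ler_wpM2r.
    by clear - jn s1; lra.
  by rewrite A_gt0// j0 ltnW.
have hm' : \forall n \near \oo,
    `|(m n)%:R - n%:R * a - 0 * Num.sqrt n%:R| <= 1.
  by apply: filterS hm => n; rewrite mul0r subr0.
have := continuous_cvg _ (@continuous_expR R _) L => /(_ _).
apply: cvg_trans; apply: near_eq_cvg; near=> n.
have kp : 0 < A R n (k n) by near: n; exact: (pos _ _ hk).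
have mp : 0 < A R n (m n) by near: n; exact: (pos _ _ hm').
by rewrite /= expRB !lnK.
Unshelve. all: by end_near. Qed.

(** * Histograms *)

Section Histogram.
Context {R : realType}.
Notation mu := (@lebesgue_measure R).
Implicit Types (p : nat -> R) (c h x t : R) (N k : nat) (P : pred nat).

(** In the variable u = c + t / h this is the unit interval [k, k+1[. *)
Definition cell c h k : set R := `[(k%:R - c) * h, (k.+1%:R - c) * h[.

(** The predicate P selects the columns that are drawn, so that a distribution
    function is the total integral of a histogram. *)
Definition histogram p c h N P t : R :=
  \sum_(0 <= k < N | P k) p k * \1_(cell c h k) t.

Lemma in_cell c h k t : 0 < h -> (t \in cell c h k) = (k%:R <= c + t / h < k.+1%:R).
Proof.
move=> h0; rewrite mem_setE in_itv/= -ler_pdivlMr// -ltr_pdivrMr//.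
by rewrite lerBlDl ltrBrDl.
Qed.

(** The cells are disjoint, so at most one term of the sum is nonzero. *)
Lemma histogram_cell p c h N P t k : 0 < h -> k%:R <= c + t / h < k.+1%:R ->
  histogram p c h N P t = if (k < N)%N && P k then p k else 0.
Proof.
move=> h0 kt; rewrite /histogram.
have E j : \1_(cell c h j) t = (j == k)%:R :> R.
  rewrite indicE in_cell//; congr (_%:R); congr nat_of_bool; apply/idP/eqP => [jt|->//].
  by rewrite -(truncn_def jt) (truncn_def kt).
under eq_bigr do rewrite E mulr_natr mulrb.
rewrite -big_mkcondr/= big_mkord; case: ifPn => [/andP[kN Pk]|kP].
  rewrite (big_pred1 (Ordinal kN))// => j /=; rewrite -val_eqE /=.
  by apply: andb_idl => /eqP ->.
rewrite big_pred0// => j; apply: contraNF kP => /andP[Pj /eqP <-].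
by rewrite Pj ltn_ord.
Qed.

Lemma histogram_lt0 p c h N P t : 0 < h -> c + t / h < 0 ->
  histogram p c h N P t = 0.
Proof.
move=> h0 t0; rewrite /histogram big1// => k _.
by rewrite indicE in_cell// leNgt (lt_le_trans t0 (ler0n R k)) mulr0.
Qed.

Lemma measurable_cell c h k : measurable (cell c h k).
Proof. exact: measurable_itv. Qed.

Lemma integrable_cellZ p c h k :
  mu.-integrable setT (fun t => (p k * \1_(cell c h k) t)%:E).
Proof.
under eq_fun do rewrite EFinM; apply: integrableZl => //.
exact: integrable_indic_itv.
Qed.

Lemma integrable_histogram p c h N P :
  mu.-integrable setT (fun t => (histogram p c h N P t)%:E).
Proof.
under eq_fun do rewrite -sumEFin.
by apply: integrable_sum => // k _; exact: integrable_cellZ.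
Qed.

Lemma Rintegral_histogram p c h N P : 0 < h ->
  \int[mu]_t histogram p c h N P t = h * \sum_(0 <= k < N | P k) p k.
Proof.
move=> h0; rewrite /Rintegral.
under eq_integral do rewrite -sumEFin.
rewrite integral_sum//; last by move=> k; exact: integrable_cellZ.
rewrite (eq_bigr (fun k => (h * p k)%:E)); last first.
  move=> k _; under eq_integral do rewrite EFinM.
  rewrite integralZl//; last exact: integrable_indic_itv.
  rewrite integral_indic ?setIT//; last exact: measurable_cell.
  rewrite /= lebesgue_measure_itv/= lte_fin ltr_pM2r// ltrD2r ltr_nat ltnSn.
  rewrite -EFinB -EFinM mulrC -mulrBl; congr (_ * _)%:E.
  by rewrite -natr1; ring.
by rewrite sumEFin/= mulr_sumr.
Qed.

Lemma Rintegral_indic_oc (x h : R) : 0 <= h ->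
  \int[mu]_t \1_`]x, x + h] t = h.
Proof.
move=> h0; rewrite /Rintegral integral_indic//= setIT.
rewrite lebesgue_measure_itv/= lte_fin; case: ltP => [xh|]/=.
  by rewrite addrAC subrr add0r.
by rewrite gerDl => h0'; apply/eqP; rewrite eq_le h0 h0'.
Qed.

End Histogram.

(** * Comparing a histogram with the Gaussian density *)

(** The centered Gaussian density of standard deviation s, without its
    normalizing constant. *)
Definition bell {R : realType} (s t : R) : R := expR (- (t ^+ 2 / (2 * s ^+ 2))).

Section Bell.
Context {R : realType}.
Notation mu := (@lebesgue_measure R).

Lemma bell_normal_pdf (s : R) : s != 0 ->
  bell s = fun t => (normal_peak s)^-1 * normal_pdf 0 s t.
Proof.
move=> s0; apply/funext => t.
rewrite normal_pdfE// mulrA mulVf ?mul1r ?gt_eqF ?normal_peak_gt0//.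
by rewrite /bell /normal_fun subr0 mulNr mulr_natl.
Qed.

Lemma integrable_bell (s : R) : s != 0 ->
  mu.-integrable setT (fun t => (bell s t)%:E).
Proof.
move=> s0; rewrite bell_normal_pdf//.
under eq_fun do rewrite EFinM; apply: integrableZl => //.
exact: integrable_normal_pdf.
Qed.

Lemma Rintegral_bell1 : \int[mu]_t bell 1 t = Num.sqrt (2 * pi).
Proof.
rewrite bell_normal_pdf ?oner_neq0// RintegralZl//; last exact: integrable_normal_pdf.
rewrite /Rintegral integral_normal_pdf/= mulr1 /normal_peak invrK expr1n mul1r.
by rewrite mulr_natl.
Qed.

Lemma bell_le1 (s t : R) : bell s t <= 1.
Proof.
by rewrite /bell expR_le1 oppr_le0 divr_ge0 ?sqr_ge0// mulr_ge0 ?sqr_ge0.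
Qed.

Lemma Rintegral_histogram_bell_dist (p : nat -> R) (c h : R) (N : nat) : 0 < h ->
  `|h * \sum_(0 <= k < N) p k - Num.sqrt (2 * pi)|
    <= \int[mu]_t `|histogram p c h N predT t - bell 1 t|.
Proof.
move=> h0; rewrite -Rintegral_bell1 -(Rintegral_histogram p c h N predT h0).
have ih := integrable_histogram p c h N predT.
have ib := integrable_bell 1 (oner_neq0 R).
rewrite -RintegralB//; apply: le_normr_Rintegral => //.
exact: (integrableB measurableT ih ib).
Qed.

(** The sum is the integral of the histogram restricted to the columns that start
    at or before x, whereas the Gaussian is cut off exactly at x. The two
    truncations agree outside ]x, x + h], and there the Gaussian is at most 1. *)
Lemma histogram_cdf_dist (p : nat -> R) (c h x : R) (N : nat) : 0 < h ->
  `|h * \sum_(0 <= k < N | k%:R <= c + x / h) p k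
     - \int[mu]_(t in `]-oo, x]) bell 1 t|
    <= \int[mu]_t `|histogram p c h N predT t - bell 1 t| + h.
Proof.
move=> h0; rewrite -(Rintegral_histogram p c h N _ h0) [X in `|_ - X|]Rintegral_mkcond.
pose P (k : nat) := k%:R <= c + x / h; rewrite -/P.
have ih Q := integrable_histogram p c h N Q.
have ib := integrable_bell 1 (oner_neq0 R).
have ibx : mu.-integrable setT (EFin \o (bell 1 \_ `]-oo, x])).
  rewrite -restrict_EFin; apply: (integrable_mkcond _ _).1 => //.
  by apply: (integrableS measurableT) => //; exact: ib.
have id : mu.-integrable setT
    (EFin \o (fun t => `|histogram p c h N predT t - bell 1 t|)).
  by apply: integrable_norm; exact: (integrableB measurableT (ih _) ib).
have ii : mu.-integrable setT (EFin \o (\1_`]x, x + h] : R -> R)).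
  exact: integrable_indic_itv.
rewrite -(RintegralB measurableT (ih P) ibx) -[X in _ <= _ + X](Rintegral_indic_oc x h (ltW h0)).
rewrite -(RintegralD measurableT id ii).
apply: (le_trans (le_normr_Rintegral _ _)) => //.
  exact: (integrableB measurableT (ih _) ibx).
apply: le_Rintegral => //.
- by apply: integrable_norm; exact: (integrableB measurableT (ih _) ibx).
- exact: (integrableD measurableT id ii).
move=> t _.
have b0 : 0 <= bell 1 t by exact: expR_ge0.
have i0 : 0 <= \1_`]x, x + h] t :> R by rewrite indicE.
have E : (bell 1 \_ `]-oo, x]) t = if t <= x then bell 1 t else 0.
  by rewrite patchE mem_setE in_itv.
rewrite E.
have [t0|t0] := ltP (c + t / h) 0.
  rewrite !histogram_lt0// !sub0r !normrN; case: ifP => _; last first.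
    by rewrite normr0 addr_ge0.
  by rewrite lerDl.
have kt := truncn_itv t0; set k := Num.truncn _ in kt.
rewrite !(histogram_cell _ _ _ _ _ _ _ h0 kt) andbT.
have [tx|xt] := leP t x.
  have -> : P k.
    move: kt => /andP[kt _]; rewrite /P (le_trans kt)// lerD2l ler_pM2r ?invr_gt0//.
  by rewrite andbT lerDl.
rewrite subr0; case Pk: (P k) => /=; last by rewrite andbF normr0 addr_ge0.
rewrite andbT indicE mem_setE in_itv/= xt/=.
have -> : t <= x + h.
  move: Pk kt; rewrite /P => Pk /andP[_].
  rewrite -natr1 => kt; have := lt_le_trans kt (lerD Pk (lexx 1)).
  rewrite -addrA ltrD2l ltr_pdivrMr// mulrDl divfK ?gt_eqF// mul1r.
  exact: ltW.
set w := (if _ then _ else _).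
have := bell_le1 1 t; have := ler_norm (w - bell 1 t).
have := ler_normD (w - bell 1 t) (bell 1 t); rewrite subrK (ger0_norm b0).
by move=> /= *; lra.
Qed.

End Bell.

(** * Convergence of the rescaled rows *)

Section Scaled.
Variables (R : realType) (a b : R).
Hypotheses (a0 : 0 < a) (a5 : 5 * a ^+ 2 = 1).
Hypotheses (b0 : 0 < b) (b2 : b ^+ 2 = 2 / 5 * a).
Notation mu := (@lebesgue_measure R).

Definition mode_weight (n k : nat) : R := A R n k / A R n (Num.truncn (n%:R * a)).
Definition scaled_histogram (n : nat) : R -> R :=
  histogram (mode_weight n) (n%:R * a) (Num.sqrt n%:R * b)^-1 n.+1 predT.

Lemma mode_itv (n : nat) : (Num.truncn (n%:R * a))%:R <= n%:R * a < (Num.truncn (n%:R * a)).+1%:R.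
Proof. by apply: truncn_itv; rewrite mulr_ge0// ltW. Qed.

Lemma A_mode_gt0 (n : nat) : (10 <= n)%N -> 0 < A R n (Num.truncn (n%:R * a)).
Proof.
move=> n10; have /andP[al au] := center_bounds _ _ a0 a5.
have n10' : 10 <= n%:R :> R by rewrite ler_nat.
have := mode_itv n; set m := Num.truncn _; rewrite -natr1 => /andP[m1 m2].
apply: A_gt0; rewrite -(ltr_nat R) -(ler_nat R); apply/andP.
by clear - al au n10' m1 m2; split; nra.
Qed.

Lemma cell_width_gt0 (n : nat) : (0 < n)%N -> 0 < (Num.sqrt n%:R * b)^-1.
Proof. by move=> n0; rewrite invr_gt0 mulr_gt0// sqrtr_gt0 ltr0n. Qed.

(** Passing from the left end of a cell, where [A_le_gauss] is applied, to a point t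
    of the cell shifts k - n a by at most 1. Half of the Gaussian rate absorbs
    this shift, hence the standard deviation 2 / b. *)
Lemma scaled_histogram_le (n : nat) (t : R) : (10 <= n)%N ->
  `|scaled_histogram n t| <= 2 * expR 1 * expR 1 * bell (2 / b) t.
Proof.
move=> n10; have h0 := cell_width_gt0 n (ltn_trans (isT : 0 < 9)%N n10).
have K0 : 0 <= 2 * expR 1 * expR 1 * bell (2 / b) t.
  by rewrite !mulr_ge0 ?expR_ge0.
rewrite /scaled_histogram.
have [t0|t0] := ltP (n%:R * a + t / (Num.sqrt n%:R * b)^-1) 0.
  by rewrite histogram_lt0// normr0.
have kt := truncn_itv t0; set k := Num.truncn _ in kt.
rewrite (histogram_cell _ _ _ _ _ _ _ h0 kt); case: ifP => _; last by rewrite normr0.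
have mp := A_mode_gt0 n n10.
have Ak : 0 <= A R n k by case: (n) n10 => // n' _; exact: A_ge0.
rewrite /mode_weight ger0_norm ?divr_ge0 ?(ltW mp)// ler_pdivrMr//.
apply: (le_trans (A_le_gauss _ _ _ _ a0 a5 n10 (mode_itv n) k)).
rewrite mulrAC ler_wpM2r ?(ltW mp)// -[leRHS]mulrA ler_wpM2l//.
rewrite /bell -expRD ler_expR.
have n0 : 0 < n%:R :> R by rewrite ltr0n (leq_trans _ n10).
have sq : Num.sqrt n%:R ^+ 2 = n%:R :> R by rewrite sqr_sqrtr// ltW.
have -> : t ^+ 2 / (2 * (2 / b) ^+ 2) = (t * (Num.sqrt n%:R * b)) ^+ 2 / (8 * n%:R).
  by rewrite !exprMn sq; field; rewrite !gt_eqF.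
move: kt; rewrite invrK -natr1; set v := t * _; clear -n0 n10 => /andP[k1 k2].
have N1 : 1 <= n%:R :> R by rewrite ler1n (leq_trans _ n10).
rewrite -subr_ge0.
have -> : 1 - v ^+ 2 / (8 * n%:R) - - ((k%:R - n%:R * a) ^+ 2 / (4 * n%:R))
   = (8 * n%:R - v ^+ 2 + 2 * (k%:R - n%:R * a) ^+ 2) / (8 * n%:R).
  by field; rewrite gt_eqF.
apply: divr_ge0; last by rewrite mulr_ge0// ltW.
have [y yE] : exists y, y = k%:R - n%:R * a by eexists.
have y1 : y <= v by rewrite yE; lra.
have y2 : v <= y + 1 by rewrite yE; lra.
rewrite -yE; clear - N1 y1 y2.
have : (v - y) ^+ 2 <= 1 by nra.
(* This is v^2 <= 2 y^2 + 2 (v - y)^2 in disguise. *)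
have := sqr_ge0 (v - 2 * y).
nra.
Qed.

(** At a fixed t the histogram eventually shows the entry of index
    floor (n a + t b sqrt n), the situation of [cvg_A_gauss]. *)
Lemma cvg_scaled_histogram (t : R) :
  scaled_histogram n t @[n --> \oo] --> bell 1 t.
Proof.
have /andP[al au] := center_bounds _ _ a0 a5.
pose k n := Num.truncn (n%:R * a + t * (Num.sqrt n%:R * b)).
have pos : \forall n \near \oo, 0 <= n%:R * a + t * (Num.sqrt n%:R * b) < n%:R.
  near=> n.
  have w0 : `|t * b| * 3 + 1 <= Num.sqrt n%:R :> R by near: n; exact: near_sqrt_ge.
  have sq : n%:R = Num.sqrt n%:R ^+ 2 :> R by rewrite sqr_sqrtr.
  move: (Num.sqrt n%:R) w0 sq => w w0 ->.
  have [tn tp] := (ler_norm (- (t * b)), ler_norm (t * b)).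
  rewrite normrN in tn.
  have nn := normr_ge0 (t * b).
  rewrite [w * b]mulrC [t * (b * w)]mulrA.
  move: (t * b) w0 tn tp nn => u; move: (`|u|) => v.
  by clear - al au; move=> *; apply/andP; split; nra.
have L := cvg_A_gauss _ a (t * b) k (fun n => Num.truncn (n%:R * a)) a0 a5 _ _.
have {L} : A R n (k n) / A R n (Num.truncn (n%:R * a)) @[n --> \oo] -->
    expR (- (25 / 4 * a * (t * b) ^+ 2)).
  apply: L.
    apply: filterS pos => n /andP[p _].
    have := truncn_itv p; rewrite -/(k n) -natr1 ler_norml => /andP[? ?].
    rewrite -[t * b * _]mulrA [b * _]mulrC.
    by apply/andP; split; lra.
  near=> n; have := mode_itv n; rewrite -natr1 ler_norml => /andP[? ?].
  by apply/andP; split; lra.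
have -> : 25 / 4 * a * (t * b) ^+ 2 = t ^+ 2 / (2 * 1 ^+ 2).
  rewrite exprMn b2.
  have -> : 25 / 4 * a * (t ^+ 2 * (2 / 5 * a)) = (5 * a ^+ 2) * t ^+ 2 / 2.
    by field.
  by rewrite a5 expr1n mul1r mulr1.
apply: cvg_trans; apply: near_eq_cvg; near=> n.
have n0 : (0 < n)%N by near: n; exists 1%N.
have /andP[p1 p2] : 0 <= n%:R * a + t * (Num.sqrt n%:R * b) < n%:R by near: n.
have kt := truncn_itv p1.
rewrite /scaled_histogram (histogram_cell _ _ _ _ _ _ (k n) (cell_width_gt0 n n0)).
  have -> // : (k n < n.+1)%N.
  by rewrite ltnS -(ler_nat R) ltW// (le_lt_trans _ p2)//; case/andP: kt.
by rewrite invrK.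
Unshelve. all: by end_near. Qed.

Lemma cvg_L1_scaled_histogram :
  \int[mu]_t `|scaled_histogram n t - bell 1 t| @[n --> \oo] --> (0 : R).
Proof.
have s0 : 2 / b != 0 by rewrite gt_eqF// divr_gt0.
have ib := integrable_bell (2 / b) s0.
have ib1 := integrable_bell 1 (oner_neq0 R).
have ih n := integrable_histogram (mode_weight n) (n%:R * a) (Num.sqrt n%:R * b)^-1 n.+1 predT.
(* The majorant is valid from row 10 on. *)
pose f_ n t : \bar R := (scaled_histogram (n + 10) t)%:E.
have [] := @dominated_convergence _ _ R mu setT measurableT f_
  (fun t => (bell 1 t)%:E)
  (fun t => (2 * expR 1 * expR 1)%:E * (bell (2 / b) t)%:E)%E.
- by move=> n; exact: (measurable_int mu (ih _)).
- exact: (measurable_int mu ib1).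
- apply: aeW => t _; apply: cvg_EFin.
    by apply: nearW.
  by have := cvg_scaled_histogram t; rewrite -(cvg_shiftn 10).
- exact: (integrableZl measurableT _ ib).
- apply: aeW => t n _; rewrite /f_ -EFinM lee_fin.
  by apply: scaled_histogram_le; rewrite leq_addl.
move=> _ cvgL1 _; rewrite -(cvg_shiftn 10).
exact: fine_cvg cvgL1.
Qed.

End Scaled.

(** The quotient S / D is at most 1, so that the error on D is not amplified. *)
Lemma ratio_dist_le (R : realFieldType) (S D G C d : R) :
  0 <= S <= D -> 0 < D -> 0 < C -> `|S - G| <= d -> `|D - C| <= d ->
  `|D^-1 * S - C^-1 * G| <= 2 * d / C.
Proof.
move=> /andP[S0 SD] D0 C0 hS hD.
have -> : D^-1 * S - C^-1 * G = ((S - G) - S / D * (D - C)) / C.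
  by field; rewrite !gt_eqF.
rewrite normrM normfV (gtr0_norm C0) ler_pM2r ?invr_gt0//.
rewrite (le_trans (ler_normB _ _))// [2 * d]mulr_natl mulr2n lerD// normrM.
rewrite (le_trans _ hD)// ler_piMl// ger0_norm ?divr_ge0 ?(ltW D0)//.
by rewrite ler_pdivrMr// mul1r.
Qed.

Lemma normalized_sum_dist_le (R : realType) (a b : R) (b_ : nat -> R) (n : nat) (x : R) :
  0 < a -> 5 * a ^+ 2 = 1 -> 0 < b -> b_ n = Num.sqrt n%:R * b -> (10 <= n)%N ->
  `|normalized_sum (fun n => n%:R * a) b_ n x - gaussian_cdf x|
    <= 2 * (\int[lebesgue_measure]_t `|scaled_histogram R a b n t - bell 1 t|
            + (Num.sqrt n%:R * b)^-1) / Num.sqrt (2 * pi).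
Proof.
move=> a0 a5 b0 bn n10.
have n0 : (0 < n)%N by exact: leq_trans n10.
have h0 := cell_width_gt0 R b b0 n n0.
have mp := A_mode_gt0 R a a0 a5 n n10.
have A0 k : 0 <= A R n k by case: (n) n0 => // n' _; exact: A_ge0.
rewrite /normalized_sum bn /scaled_histogram.
set h := (_ * b)^-1 in h0 *; set c := n%:R * a.
have -> : x * (Num.sqrt n%:R * b) = x / h by rewrite /h invrK.
have scale P : h * \sum_(0 <= k < n.+1 | P k) mode_weight R a n k
    = h / A R n (Num.truncn c) * \sum_(0 <= k < n.+1 | P k) A R n k.
  by rewrite /mode_weight -mulr_suml mulrA mulrAC.
have q0 : 0 < h / A R n (Num.truncn c) by rewrite divr_gt0.
have sumA0 : 0 < \sum_(0 <= k < n.+1) A R n k.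
  rewrite big_nat_recr//= ltr_wpDl ?sumr_ge0//.
  by apply: A_gt0; rewrite n0 leqnn.
have le_sumA (P : pred nat) :
    0 <= \sum_(0 <= k < n.+1 | P k) A R n k <= \sum_(0 <= k < n.+1) A R n k.
  rewrite sumr_ge0//= big_mkcond /=.
  by apply: ler_sum => k _; case: ifP.
have := Rintegral_histogram_bell_dist (mode_weight R a n) c h n.+1 h0.
have := histogram_cdf_dist (mode_weight R a n) c h x n.+1 h0.
rewrite !scale; move: (h / _) q0 => q q0.
have /= := le_sumA (fun k => k%:R <= c + x / h).
move: (\sum_(_ <= k < _ | _) _) (\sum_(_ <= k < _) _) sumA0 => S D D0.
move=> /andP[S0 SD] hS hD.
have C0 : 0 < Num.sqrt (2 * pi) :> R by rewrite sqrtr_gt0 mulr_gt0 ?pi_gt0.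
have -> : D^-1 * S = (q * D)^-1 * (q * S) by field; rewrite !gt_eqF.
have -> : gaussian_cdf x
    = (Num.sqrt (2 * pi))^-1 * \int[lebesgue_measure]_(t in `]-oo, x]) bell 1 t.
  congr (_ * _); apply: eq_Rintegral => t _.
  by rewrite /bell expr1n mulr1.
apply: ratio_dist_le => //.
- by rewrite mulr_ge0 ?(ltW q0)//= ler_pM2l.
- by rewrite mulr_gt0.
- by rewrite (le_trans hD)// lerDl ltW.
Qed.

Lemma limit_relation_scaled (R : realType) (a b : R) (b_ : nat -> R) :
  0 < a -> 5 * a ^+ 2 = 1 -> 0 < b -> b ^+ 2 = 2 / 5 * a ->
  (\forall n \near \oo, b_ n = Num.sqrt n%:R * b) ->
  limit_relation (fun n => n%:R * a) b_.
Proof.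
move=> a0 a5 b0 b2 hb; rewrite /limit_relation.
pose B (n : nat) : R :=
  2 * (\int[lebesgue_measure]_t `|scaled_histogram R a b n t - bell 1 t|
            + (Num.sqrt n%:R * b)^-1) / Num.sqrt (2 * pi).
have B0 : (B n)%:E @[n --> \oo] --> 0%E.
  apply: cvg_EFin; first exact: nearW.
  have -> : 0 = 2 * (0 + 0 * b^-1) / Num.sqrt (2 * pi) :> R.
    by rewrite mul0r addr0 mulr0 mul0r.
  apply: cvgMl; apply: cvgMr; apply: cvgD.
    exact: cvg_L1_scaled_histogram.
  under eq_fun do rewrite invfM.
  by apply: cvgMl; exact: cvg_invsqrt.
apply: (squeeze_cvge _ _ B0); last exact: cvg_cst.
near=> n; apply/andP; split.
  apply: le_ereal_sup_tmp.
  exists (`|normalized_sum (fun n => n%:R * a) b_ n 0 - gaussian_cdf 0|%:E).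
    by exists 0.
  by rewrite lee_fin.
apply: ge_ereal_sup => _ [x _ <-]; rewrite lee_fin.
apply: normalized_sum_dist_le => //; near: n => //.
Unshelve. all: by end_near. Qed.

Theorem theorem1p1 (R : realType) :
  (exists a b : nat -> R, (forall n : nat, 0 < b n) /\ limit_relation a b) /\
  (forall a b : R, a = 1 / Num.sqrt 5 -> 0 < b ->
     b ^+ 2 = 2 / 5 * (1 / Num.sqrt 5) ->
     limit_relation (fun n : nat => n%:R * a) (fun n : nat => Num.sqrt n%:R * b)).
Proof.
have a0 : 0 < 1 / Num.sqrt 5 :> R by rewrite divr_gt0// sqrtr_gt0.
have a5 : 5 * (1 / Num.sqrt 5) ^+ 2 = 1 :> R.
  by rewrite expr_div_n expr1n sqr_sqrtr// mul1r divff.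
split; last first.
  move=> a b aE b0 b2; apply: (limit_relation_scaled R a b) => //; rewrite ?aE//.
  exact: nearW.
pose b : R := Num.sqrt (2 / 5 * (1 / Num.sqrt 5)).
have c0 : 0 < 2 / 5 * (1 / Num.sqrt 5) :> R by rewrite mulr_gt0// divr_gt0.
have b0 : 0 < b by rewrite sqrtr_gt0.
(* The natural scale vanishes at 0, where any positive value will do. *)
exists (fun n => n%:R * (1 / Num.sqrt 5)),
  (fun n => if n is 0%N then 1 else Num.sqrt n%:R * b); split.
  by case=> [|n]//; rewrite mulr_gt0// sqrtr_gt0 ltr0n.
apply: (limit_relation_scaled R _ b) => //; first by rewrite sqr_sqrtr// ltW.
by exists 1%N => // -[].
Qed.
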